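(* Let $a,b,m,n\geqslant 1$ be integers. Then $$\frac{1-q^{\gcd(am,m+n)}}{1-q^{m+n}}{am+bm-1\brack am}_q{an+bn\brack an}_q$$ is a polynomial in $q$ with non-negative integer coefficients.
   Context: The $q$-binomial coefficients are defined by ${n\brack k}_q=\dfrac{(1-q^n)(1-q^{n-1})\cdots(1-q^{n-k+1})}{(1-q)(1-q^2)\cdots(1-q^k)}$ if $0\leqslant k\leqslant n$, and ${n\brack k}_q=0$ otherwise. Here $q$ is an indeterminate and $\gcd$ denotes the greatest common divisor. *)

(* Defs.v *)
From mathcomp Require Import all_boot all_order all_algebra.

Set Implicit Arguments.
Unset Strict Implicit.
Unset Printing Implicit Defensive.

Import GRing.Theory.
Local Open Scope ring_scope.

(* The indeterminate q, as an element of the field of fractions of Z[q]. *)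
Definition qvar : {fraction {poly int}} := FracField.tofrac 'X.

(* The exponent n - i is a natural-number subtraction; it is never truncated,
   since i < k <= n. *)
Definition qbinom (n k : nat) : {fraction {poly int}} :=
  if (k <= n)%N then
    (\prod_(i < k) (1 - qvar ^+ (n - i))) / (\prod_(i < k) (1 - qvar ^+ i.+1))
  else 0.

Definition is_nonneg_int_poly (f : {fraction {poly int}}) : Prop :=
  exists p : {poly int},
    f = FracField.tofrac p /\ (forall i : nat, (0 : int) <= p`_i).

(* Main.v *)
Require Import Defs.
From mathcomp Require Import all_boot all_order all_algebra.
From mathcomp Require Import perm all_field realalg ring zify.

Import Order.TTheory GRing.Theory Num.Theory.

Local Open Scope ring_scope.

(* Let M = m + n, j = gcd(am, M), and let A, B be the two Gaussian polynomials.

   Divisibility. Let z be a primitive d-th root of unity with d | M. If d does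
   not divide am, there is a carry modulo d in exactly one of the additions
   am + (bm - 1) and an + bn, so A(z)B(z) = 0. Hence 1 - q^M divides
   (1 - q^am)AB, and by Bezout also (1 - q^j)AB; say (1 - q^j)AB = (1 - q^M)g.

   Positivity. The product AB is reciprocal and unimodal, so the coefficients
   of (1 - q^j)AB, and therefore those of g, are nonnegative up to the middle
   degree of g. As g is itself reciprocal, all its coefficients are
   nonnegative.

   Unimodality of [N, k]. The coefficients count k-subsets S of
   {0, ..., N - 1} by their sum, i.e. the weight spaces of the k-th exterior
   power of the irreducible sl_2-module of dimension N. In a suitable
   orthonormal basis the raising operator e and the lowering operator satisfy
   f = e^T, so e e^T = e^T e + h with h > 0 below the middle weight, which makes
   e injective there. *)

(* If u is the raising matrix, the last hypothesis reads u u^T = u^T u + h on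
   A, so u is injective on the space spanned by A. *)
Lemma leq_card_raising {T : finType} {R : realFieldType} (u : T -> T -> R)
    (h : R) (A B : {set T}) :
  0 < h ->
  {in A, forall s v, u s v != 0 -> v \in B} ->
  {in A &, forall s t, \sum_v u s v * u t v
                       = \sum_v u v s * u v t + (s == t)%:R * h} ->
  (#|A| <= #|B|)%N.
Proof.
move=> h_gt0 uAB comm.
pose M : 'M[R]_(#|A|, #|B|) := \matrix_(p, q) u (enum_val p) (enum_val q).
suff /eqP <- : row_free M by apply: rank_leq_col.
apply: inj_row_free => x xM0.
have xu0 v : \sum_p x 0 p * u (enum_val p) v = 0.
  have [vB|vB] := boolP (v \in B).
    move/matrixP/(_ 0 (enum_rank_in vB v)): xM0; rewrite !mxE => E.
    by rewrite -[RHS]E; apply: eq_bigr => p _; rewrite mxE enum_rankK_in.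
  apply: big1 => p _; have [->|nz] := eqVneq (u (enum_val p) v) 0.
    by rewrite mulr0.
  by rewrite (uAB _ (enum_valP p) v nz) in vB.
have quad (f : T -> T -> R) : \sum_p \sum_q x 0 p * x 0 q
      * (\sum_v f (enum_val p) v * f (enum_val q) v)
    = \sum_v (\sum_p x 0 p * f (enum_val p) v) ^+ 2.
  transitivity (\sum_p \sum_q \sum_v (x 0 p * f (enum_val p) v)
      * (x 0 q * f (enum_val q) v)).
    apply: eq_bigr => p _; apply: eq_bigr => q _.
    by rewrite mulr_sumr; apply: eq_bigr => v _; ring.
  under eq_bigr do rewrite exchange_big.
  rewrite exchange_big; apply: eq_bigr => v _ /=.
  by under eq_bigr do rewrite -mulr_sumr; rewrite -mulr_suml expr2.
have diag p : \sum_q x 0 p * x 0 q * ((enum_val p == enum_val q)%:R * h)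
    = x 0 p ^+ 2 * h.
  rewrite (bigD1 p) //= eqxx mul1r big1 ?addr0 -?expr2 // => q.
  by rewrite (inj_eq enum_val_inj) eq_sym => /negPf->; rewrite mul0r mulr0.
(* Summing the hypothesis against x_p x_q turns [xu0] into 0 = |x u|^2 = |x u^T|^2 + h |x|^2; both
   summands are nonnegative, so x = 0. *)
have /eqP := quad u; rewrite [X in _ == X]big1 => [|v _].
  rewrite (eq_bigr (fun p => \sum_q x 0 p * x 0 q
      * (\sum_v u v (enum_val p) * u v (enum_val q)) + x 0 p ^+ 2 * h)).
    rewrite big_split /= (quad (fun s v => u v s)) -mulr_suml.
    rewrite paddr_eq0 ?mulr_ge0 ?sumr_ge0 ?(ltW h_gt0) // => [|p _|v _].
    - case/andP => _; rewrite mulf_eq0 (gt_eqF h_gt0) orbF => /eqP sum0.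
      apply/rowP => p; rewrite mxE; apply/eqP; rewrite -(sqrf_eq0 (x 0 p)).
      by apply/eqP/(psumr_eq0P _ sum0) => // q _; apply: sqr_ge0.
    - exact: sqr_ge0.
    - exact: sqr_ge0.
  move=> p _; rewrite -diag -big_split; apply: eq_bigr => q _ /=.
  by rewrite comm ?enum_valP // mulrDr.
by rewrite xu0 expr0n.
Qed.

(** * Gaussian polynomials *)

(** The q-Pascal rule stays in Z[q] without division; [qbinomE] identifies the result with the
    quotient. *)
Fixpoint gauss (n k : nat) : {poly int} :=
  match n, k with
  | _, 0 => 1
  | 0, _.+1 => 0
  | n'.+1, k'.+1 => 'X^k * gauss n' k + gauss n' k'
  end.

Lemma gauss0 n : gauss n 0 = 1. Proof. by case: n. Qed.

Lemma gaussS n k :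
  gauss n.+1 k.+1 = 'X^(k.+1) * gauss n k.+1 + gauss n k.
Proof. by []. Qed.

Arguments gauss : simpl never.

Lemma gauss_small n k : (n < k)%N -> gauss n k = 0.
Proof.
elim: n k => [|n IH] [|k] //; rewrite ltnS => nk.
by rewrite gaussS !IH ?mulr0 ?addr0 // ltnW.
Qed.

(** A division-free product formula, on which reciprocity, vanishing at roots of unity and [qbinomE]
    all rest. For n <= k both sides are 0, so the truncation of n - k is harmless. *)
Lemma gauss_ratio n k :
  (1 - 'X^(k.+1)) * gauss n k.+1 = (1 - 'X^(n - k)) * gauss n k.
Proof.
elim: n k => [|n IH] [|k];
  try by rewrite gauss_small // sub0n subrr mulr0 mul0r.
  have := IH 0; rewrite gaussS !gauss0 subn0 !mulr1 => IH0.
  by rewrite mulrDr mulrCA IH0 (exprS _ n) subn0; ring.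
rewrite !gaussS subSS mulrDr mulrCA (IH k.+1) (mulrDr (1 - 'X^(n - k))).
rewrite -(IH k).
have [nk|kn] := leqP n k.
  by rewrite (gauss_small n k.+1) // !mulr0.
have -> : 'X^(k.+2) = 'X^(k.+1) * 'X :> {poly int} by rewrite exprSr.
have -> : (n - k = (n - k.+1).+1)%N by lia.
by rewrite (exprS _ (n - k.+1)); ring.
Qed.

Lemma gaussS_top n k :
  gauss n.+1 k.+1 = gauss n k.+1 + 'X^(n - k) * gauss n k.
Proof.
have -> : 'X^(n - k) * gauss n k
    = gauss n k - (1 - 'X^(k.+1)) * gauss n k.+1 by rewrite gauss_ratio; ring.
by rewrite gaussS; ring.
Qed.

(** The finite q-binomial theorem: q is the inner variable, and the outer one will record the size
    of a subset. *)
Lemma prod_gauss n :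
  \prod_(i < n) (1 + 'X^i *: 'X) =
  \poly_(k < n.+1) ('X^'C(k, 2) * gauss n k) :> {poly {poly int}}.
Proof.
elim: n => [|n IH]; first by rewrite big_ord0 poly_def big_ord1 mulr1 scale1r.
rewrite big_ord_recr /= IH mulrDr mulr1.
apply/polyP => k; rewrite coefD -scalerAr coefZ coefMX !coef_poly.
case: k => [|k] /=; first by rewrite !gauss0 mulr0 addr0.
rewrite !ltnS; case: ltngtP => [kn|kn|->].
- rewrite gaussS_top mulrDr !mulrA -!exprD binS bin1.
  by congr (_ + 'X^_ * _); lia.
- by rewrite mulr0 addr0.
- rewrite add0r gaussS (gauss_small n n.+1) // mulr0 add0r mulrA -exprD.
  by rewrite binS bin1 addnC.
Qed.

Lemma sum_set_exp n k :
  \sum_(S : {set 'I_n} | #|S| == k) 'X^(\sum_(i in S) i)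
    = 'X^'C(k, 2) * gauss n k :> {poly int}.
Proof.
have := prod_gauss n; under eq_bigr do rewrite addrC.
rewrite bigA_distr => /(congr1 (fun p : {poly {poly int}} => p`_k)).
rewrite coef_poly ltnS coef_sum => E.
transitivity (if (k <= n)%N then 'X^'C(k, 2) * gauss n k else 0); last first.
  by case: leqP => // /gauss_small->; rewrite mulr0.
rewrite -E big_mkcond; apply: eq_bigr => S _.
rewrite -big_mkcond /= scaler_prod prodr_const coefZ coefXn -expr_sum.
by rewrite eq_sym; case: eqP; rewrite ?mulr1 ?mulr0.
Qed.

(** The shift 'C(k, 2) = 0 + 1 + ... + (k - 1) is the least sum of a k-subset. *)
Lemma coef_gauss n k r :
  (gauss n k)`_r =
  #|[set S : {set 'I_n} | (#|S| == k) && (\sum_(i in S) i == r + 'C(k, 2))%N]|.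
Proof.
have := congr1 (fun p : {poly int} => p`_(r + 'C(k, 2))) (sum_set_exp n k).
rewrite coefXnM ltnNge leq_addl addnK /= => <-.
rewrite coef_sum (eq_bigr _ (fun _ _ => coefXn _ _ _)) -sum1dep_card.
rewrite -natz natr_sum big_mkcondr /=; apply: eq_bigr => S _.
by rewrite eq_sym; case: eqP.
Qed.

(** * Unimodality of Gaussian polynomials *)

Section Fermions.

Variable M : nat.
Implicit Types (i j : 'I_M) (S T V : {set 'I_M.+1}).

Definition site i : 'I_M.+1 := widen_ord (leqnSn M) i.
Definition next_site i : 'I_M.+1 := lift ord0 i.

(** A set is a configuration of particles, standing for a wedge of basis vectors. Swapping two sites
    makes [hop i] total and involutive; the guards below single out the actual moves. *)
Definition hop i S : {set 'I_M.+1} :=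
  [set x | tperm (site i) (next_site i) x \in S].

Definition can_hop i S := (site i \in S) && (next_site i \notin S).
Definition can_hop_back i S := (site i \notin S) && (next_site i \in S).

Lemma hopK i : involutive (hop i).
Proof. by move=> S; apply/setP => x; rewrite !inE tpermK. Qed.

Lemma mem_site_hop i S : (site i \in hop i S) = (next_site i \in S).
Proof. by rewrite inE tpermL. Qed.

Lemma mem_next_site_hop i S : (next_site i \in hop i S) = (site i \in S).
Proof. by rewrite inE tpermR. Qed.

Lemma can_hop_hop i S : can_hop i (hop i S) = can_hop_back i S.
Proof.
by rewrite /can_hop /can_hop_back mem_site_hop mem_next_site_hop andbC.
Qed.

Lemma can_hop_back_hop i S : can_hop_back i (hop i S) = can_hop i S.
Proof.
by rewrite /can_hop /can_hop_back mem_site_hop mem_next_site_hop andbC.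
Qed.

Lemma mem_hop_far i S x :
  x != site i -> x != next_site i -> (x \in hop i S) = (x \in S).
Proof. by move=> xi xi'; rewrite inE tpermD // eq_sym. Qed.

Definition far_apart i j :=
  [&& site i != site j, site i != next_site j,
      next_site i != site j & next_site i != next_site j].

Lemma hop_commute i j S : far_apart i j -> hop i (hop j S) = hop j (hop i S).
Proof.
case/and4P => *; apply/setP => x; rewrite !inE -!permM.
suff -> : (tperm (site i) (next_site i) * tperm (site j) (next_site j)
  = tperm (site j) (next_site j) * tperm (site i) (next_site i))%g by [].
by rewrite [LHS]conjgC tpermJ !tpermD // eq_sym.
Qed.

(** In the common image V, sites i and j are empty and their right neighbours occupied. Hence the
    two edges are disjoint, the swaps commute, and the moves can be made in the other order. *)
Lemma hop_hop_back i j S T : i != j ->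
  [&& can_hop i S, can_hop j T & hop i S == hop j T] ->
  [&& can_hop_back j S, can_hop_back i T & hop j S == hop i T].
Proof.
move=> ij /and3P[iS jT /eqP E].
rewrite -[S](hopK i) -[T](hopK j) -E in iS jT *.
rewrite !can_hop_hop in iS jT.
move: (hop i S) iS jT {E} => V /andP[i0 i1] /andP[j0 j1].
have far : far_apart i j.
  rewrite /far_apart; apply/and4P; split.
  - by apply: contraNneq ij => /(congr1 val) E; apply/eqP/val_inj.
  - by apply: contraNneq i0 => ->.
  - by apply: contraNneq j0 => <-.
  - by apply: contraNneq ij => /lift_inj->.
have /and4P[*] := far.
rewrite (hop_commute i j V far) eqxx andbT /can_hop_back.
by rewrite !mem_hop_far ?j0 ?j1 ?i0 ?i1 // eq_sym.
Qed.

Lemma hop_back_hop i j S T : i != j ->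
  [&& can_hop_back i S, can_hop_back j T & hop i S == hop j T] ->
  [&& can_hop j S, can_hop i T & hop j S == hop i T].
Proof.
move=> ij /and3P[iS jT /eqP E].
rewrite -[S](hopK i) -[T](hopK j) -E in iS jT *.
rewrite !can_hop_back_hop in iS jT.
move: (hop i S) iS jT {E} => V /andP[i0 i1] /andP[j0 j1].
have far : far_apart i j.
  rewrite /far_apart; apply/and4P; split.
  - by apply: contraNneq ij => /(congr1 val) E; apply/eqP/val_inj.
  - by apply: contraNneq j1 => <-.
  - by apply: contraNneq i1 => ->.
  - by apply: contraNneq ij => /lift_inj->.
have /and4P[*] := far.
rewrite (hop_commute i j V far) eqxx andbT /can_hop.
by rewrite !mem_hop_far ?j0 ?j1 ?i0 ?i1 // eq_sym.
Qed.

Lemma card_hop i S : #|hop i S| = #|S|.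
Proof.
rewrite -(card_imset S (@perm_inj _ (tperm (site i) (next_site i)))).
apply: eq_card => x; rewrite inE; apply/idP/imsetP => [xS|[y yS ->]].
  by exists (tperm (site i) (next_site i) x); rewrite ?tpermK.
by rewrite tpermK.
Qed.

Lemma sum_hop i S : can_hop i S ->
  (\sum_(x in hop i S) x = (\sum_(x in S) x).+1)%N.
Proof.
case/andP => i0 i1; rewrite (bigD1 (next_site i)) ?mem_next_site_hop //=.
rewrite [in RHS](bigD1 (site i)) //= addSn; congr (_ + _).+1.
apply: eq_bigl => x.
have [->|xi] := eqVneq x (site i).
  by rewrite andbF mem_site_hop (negPf i1).
have [->|xi'] := eqVneq x (next_site i); first by rewrite andbF (negPf i1).
by rewrite mem_hop_far.
Qed.

Variable R : rcfType.

(* The entries of the raising operator of the irreducible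
   sl_2-module of dimension M + 1, in an orthonormal weight basis. *)
Definition hop_weight i : R := Num.sqrt (i.+1 * (M - i))%:R.

(** The induced action on the exterior power. No signs occur, since a move to an adjacent empty site
    keeps the order of the wedge factors. *)
Definition hop_mx (c : 'I_M -> {set 'I_M.+1} -> bool) S T : R :=
  \sum_i hop_weight i * (c i S && (hop i S == T))%:R.

Lemma hop_mxC S T : hop_mx can_hop S T = hop_mx can_hop_back T S.
Proof.
apply: eq_bigr => i _; have -> : (hop i T == S) = (hop i S == T).
  by apply/eqP/eqP => <-; rewrite hopK.
case: eqP => [<-|_]; last by rewrite !andbF.
by rewrite can_hop_back_hop.
Qed.

Lemma sum_hop_mx c S T :
  \sum_V hop_mx c S V * hop_mx c T V = \sum_i \sum_j
    hop_weight i * hop_weight j * [&& c i S, c j T & hop i S == hop j T]%:R.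
Proof.
transitivity (\sum_V \sum_i \sum_j (hop_weight i * hop_weight j
    * (c i S && c j T)%:R) * ((hop i S == V) && (hop j T == V))%:R).
  apply: eq_bigr => V _; rewrite mulr_suml; apply: eq_bigr => i _.
  rewrite mulr_sumr; apply: eq_bigr => j _; rewrite -!mulnb !natrM; ring.
rewrite exchange_big; apply: eq_bigr => i _.
rewrite exchange_big; apply: eq_bigr => j _ /=.
rewrite -mulr_sumr (bigD1 (hop i S)) //= eqxx big1 ?addr0 => [|V].
  by rewrite -mulrA -natrM mulnb -andbA (eq_sym (hop j T)).
by rewrite eq_sym => /negPf->.
Qed.

Lemma sqr_hop_weight i : hop_weight i * hop_weight i = (i.+1 * (M - i))%:R.
Proof. by rewrite -expr2 sqr_sqrtr // ler0n. Qed.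

(** The eigenvalue of [e, f] on S. The guards differ by [i in S] - [i + 1 in S], so x in S receives
    (x + 1)(M - x) - x(M + 1 - x) = M - 2x. *)
Lemma sum_weight_diff S :
  \sum_(i < M) (i.+1 * (M - i))%:R * ((can_hop i S)%:R - (can_hop_back i S)%:R)
    = #|S|%:R * M%:R - 2 * (\sum_(x in S) x)%:R :> R.
Proof.
transitivity (\sum_(i < M) (i.+1 * (M - i))%:R * (site i \in S)%:R
    - \sum_(i < M) (i.+1 * (M - i))%:R * (next_site i \in S)%:R : R).
  rewrite -sumrB; apply: eq_bigr => i _; rewrite -mulrBr /can_hop /can_hop_back.
  by case: (site i \in S); case: (next_site i \in S) => /=; ring.
transitivity (\sum_(x < M.+1) (x.+1 * (M - x))%:R * (x \in S)%:R
    - \sum_(x < M.+1) (x * (M.+1 - x))%:R * (x \in S)%:R : R).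
  congr (_ - _).
    by rewrite big_ord_recr /= subnn muln0 mul0r addr0.
  rewrite big_ord_recl mul0n mul0r add0r; apply: eq_bigr => i _ /=.
  by rewrite /bump add1n subSS.
rewrite -sumrB -sum1_card !natr_sum mulr_suml mulr_sumr -sumrB big_mkcond.
rewrite [RHS]big_mkcond /=.
apply: eq_bigr => x _; case: (x \in S); last by rewrite !mulr0 subrr.
have xM : (x <= M)%N by rewrite -ltnS.
by rewrite !mulr1 !natrM !natrB ?(leqW xM) // -(natr1 x) -(natr1 M); ring.
Qed.

(** Terms with i != j cancel after exchanging i and j; those with i = j give [sum_weight_diff]. *)
Lemma hop_mx_commutator S T :
  \sum_V hop_mx can_hop S V * hop_mx can_hop T V
    = \sum_V hop_mx can_hop V S * hop_mx can_hop V T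
      + (S == T)%:R * (#|S|%:R * M%:R - 2 * (\sum_(x in S) x)%:R).
Proof.
under [X in _ = X + _]eq_bigr do rewrite !(hop_mxC _ S) !(hop_mxC _ T).
rewrite !sum_hop_mx [X in X + _]exchange_big -sum_weight_diff.
rewrite mulr_sumr -big_split /=; apply: eq_bigr => i _.
rewrite (bigD1 i) // [in RHS](bigD1 i) //= addrAC; congr (_ + _); last first.
  apply: eq_bigr => j; rewrite eq_sym => ij.
  rewrite (mulrC (hop_weight j)); congr (_ * (nat_of_bool _)%:R).
  apply/idP/idP; first exact: hop_hop_back.
  by apply: hop_back_hop; rewrite eq_sym.
rewrite sqr_hop_weight (inj_eq (inv_inj (hopK i))).
case: (S =P T) => [->|_]; last by rewrite !andbF mulr0 mul0r addr0.
rewrite !andbT !andbb mul1r; ring.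
Qed.

End Fermions.

Lemma gauss_coef_le_succ n k r :
  (2 * r < k * (n - k))%N -> (gauss n k)`_r <= (gauss n k)`_r.+1.
Proof.
case: n => [|M] lt; first by rewrite muln0 ltn0 in lt.
have kM : (k <= M)%N by rewrite leqNgt; apply/negP => Mk; nia.
rewrite !coef_gauss lez_nat.
(* With n = M + 1 this eigenvalue equals k(n - k) - 2r, positive exactly below the middle degree. *)
pose h : realalg := (k%:R * M%:R - 2 * (r + 'C(k, 2))%:R).
have h_gt0 : 0 < h.
  rewrite subr_gt0 -!natrM ltr_nat.
  have : (2 * 'C(k, 2) = k * (k - 1))%N.
    by case: (k) => // j; rewrite -mul_bin_diag bin1 subn1.
  nia.
apply: (leq_card_raising (@hop_mx M realalg (can_hop M)) h _ _ h_gt0)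
  => [S|S T].
  rewrite !inE => /andP[/eqP Sk /eqP Sr] T; rewrite /hop_mx => nz.
  have /existsP[i /andP[iS /eqP <-]] :
      [exists i, can_hop M i S && (hop M i S == T)].
    apply: contraNT nz => /existsPn no.
    by apply/eqP/big1 => i _; rewrite (negPf (no i)) mulr0.
  by rewrite inE card_hop Sk sum_hop // Sr eqxx addSn /=.
rewrite !inE => /andP[/eqP Sk /eqP Sr] _.
by rewrite hop_mx_commutator Sk Sr.
Qed.

(** * Reciprocal and unimodal polynomials *)

Lemma qvar_neq0 : qvar != 0.
Proof. by rewrite tofrac_eq0 polyX_eq0. Qed.

Definition rev_poly (d : nat) (p : {poly int}) : {poly int} :=
  \poly_(i < d.+1) p`_(d - i).

(** Reversal as q^d p(1/q), a form in which multiplicativity is immediate. *)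
Lemma tofrac_rev_poly d (p : {poly int}) : (size p <= d.+1)%N ->
  FracField.tofrac (rev_poly d p) = qvar ^+ d * (map_poly intr p).[qvar^-1].
Proof.
move=> sz; rewrite (horner_coef_wide _ (leq_trans (size_poly _ _) sz)).
rewrite /rev_poly poly_def rmorph_sum mulr_sumr (reindex_inj rev_ord_inj) /=.
apply: eq_bigr => i _; rewrite coef_map /= subSS subKn ?leq_ord //.
rewrite -mul_polyC rmorphM rmorphXn /= -/qvar mulrCA; congr (_ * _).
  by rewrite -[X in X%:P]intz rmorph_int rmorph_int.
by rewrite exprVn -exprB ?leq_ord // unitfE qvar_neq0.
Qed.

Lemma rev_polyM d e (p r : {poly int}) :
  (size p <= d.+1)%N -> (size r <= e.+1)%N ->
  rev_poly (d + e) (p * r) = rev_poly d p * rev_poly e r.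
Proof.
move=> szp szr; apply/eqP; rewrite -tofrac_eq tofracM !tofrac_rev_poly //.
  by rewrite rmorphM hornerM exprD mulrACA.
by rewrite (leq_trans (size_polyMleq _ _)) //; lia.
Qed.

Definition reciprocal d (p : {poly int}) :=
  (size p <= d.+1)%N /\ rev_poly d p = p.

Lemma reciprocal_coef d p i : reciprocal d p -> (i <= d)%N -> p`_(d - i) = p`_i.
Proof. by move=> [_ E] id; rewrite -[in RHS]E coef_poly ltnS id. Qed.

Lemma reciprocalM d e (p r : {poly int}) :
  reciprocal d p -> reciprocal e r -> reciprocal (d + e) (p * r).
Proof.
move=> [szp Ep] [szr Er]; split; last by rewrite rev_polyM // Ep Er.
by rewrite (leq_trans (size_polyMleq _ _)) //; lia.
Qed.

Lemma size_1subXn a : (0 < a)%N -> size (1 - 'X^a : {poly int})%R = a.+1.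
Proof. by move=> a_gt0; rewrite -opprB size_polyN size_XnsubC. Qed.

Lemma size_1subXn_leq a : (size (1 - 'X^a : {poly int})%R <= a.+1)%N.
Proof. by case: a => [|a]; rewrite ?subrr ?size_poly0 ?size_1subXn. Qed.

Lemma subXn_neq0 a : (0 < a)%N -> 1 - 'X^a != 0 :> {poly int}.
Proof. by move=> a_gt0; rewrite -size_poly_gt0 size_1subXn. Qed.

Lemma rev_poly_1subXn a : rev_poly a (1 - 'X^a) = - (1 - 'X^a).
Proof.
apply/polyP => i; rewrite coef_poly coefN !coefB !coef1 !coefXn ltnS.
have [ia|ia] := leqP i a; last first.
  by rewrite (gtn_eqF ia) (gtn_eqF (leq_ltn_trans _ ia)).
rewrite opprB; congr ((nat_of_bool _)%:R - (nat_of_bool _)%:R); lia.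
Qed.

(** Both factors 1 - X^a and 1 - X^b change sign under reversal, so the signs cancel. *)
Lemma reciprocal_cancel d a b e (p r : {poly int}) :
  (0 < a)%N -> (e + a = d + b)%N -> reciprocal d r ->
  p * (1 - 'X^a) = r * (1 - 'X^b) -> reciprocal e p.
Proof.
move=> a_gt0 eadb [szr Er] E.
have szp : (size p <= e.+1)%N.
  have [->|p0] := eqVneq p 0; first by rewrite size_poly0.
  have := size_mul p0 (subXn_neq0 _ a_gt0); rewrite E size_1subXn // => szE.
  have := size_polyMleq r (1 - 'X^b); rewrite szE.
  move: (size_1subXn_leq b) szr; move: (size _) (size _) (size _); lia.
split => //; apply: (mulIf (subXn_neq0 _ a_gt0)); apply: oppr_inj.
rewrite -mulrN -rev_poly_1subXn -rev_polyM ?size_1subXn_leq // E eadb.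
by rewrite rev_polyM ?size_1subXn_leq // Er rev_poly_1subXn mulrN.
Qed.

Lemma reciprocal_gauss n k : (k <= n)%N -> reciprocal (k * (n - k)) (gauss n k).
Proof.
elim: k => [|k IH] kn.
  rewrite gauss0; split; first by rewrite size_poly1.
  by apply/polyP => i; rewrite coef_poly !coef1; case: i.
apply: (reciprocal_cancel _ k.+1 (n - k) _ _ _ _ _ (IH (ltnW kn))) => //.
  nia.
by rewrite mulrC gauss_ratio mulrC.
Qed.

(** The second clause compares i with any j >= i at least as close to d/2, even beyond the
    middle. *)
Definition unimodal d (p : {poly int}) :=
  (forall i, 0 <= p`_i) /\
  (forall i j, (i <= j)%N -> (i + j <= d)%N -> p`_i <= p`_j).

Lemma unimodal_of_succ d p : reciprocal d p -> (forall i, 0 <= p`_i) ->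
  (forall i, (2 * i < d)%N -> p`_i <= p`_i.+1) -> unimodal d p.
Proof.
move=> rec nneg succ; split=> // i j.
have low l m : (l <= m)%N -> (2 * m <= d.+1)%N -> p`_l <= p`_m.
  move=> /subnK <-; elim: (m - l)%N => [|t IH] //= le.
  by apply: le_trans (IH _) (succ _ _); lia.
move=> ij ijd; have [?|?] := leqP (2 * j) d.+1; first exact: low.
by rewrite -(reciprocal_coef _ _ _ rec (_ : j <= d)%N); [apply: low|]; lia.
Qed.

Lemma unimodal_gauss n k : (k <= n)%N -> unimodal (k * (n - k)) (gauss n k).
Proof.
move=> kn; apply: unimodal_of_succ; first exact: reciprocal_gauss.
  by move=> i; rewrite coef_gauss.
by move=> i; apply: gauss_coef_le_succ.
Qed.

(** Successive differences of p r are coefficients of (1 - X) r p, where (1 - X) r is antireciprocal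
    and nonnegative up to its middle. *)
Lemma unimodalM d e (p r : {poly int}) : reciprocal d p -> reciprocal e r ->
  unimodal d p -> unimodal e r -> unimodal (d + e) (p * r).
Proof.
move=> rec_p rec_r [p_ge0 p_mono] [r_ge0 r_mono].
apply: unimodal_of_succ; first exact: reciprocalM.
  by move=> i; rewrite coefM sumr_ge0 // => j _; rewrite mulr_ge0.
move=> k kde; rewrite -subr_ge0.
pose D : {poly int} := (1 - 'X) * r.
(* The explicit 0 keeps truncated subtraction from yielding p_0. *)
pose P j := if (k.+1 < j)%N then 0 else p`_(k.+1 - j).
have D_coef j : D`_j = r`_j - (if j is j'.+1 then r`_j' else 0).
  by rewrite /D mulrBl mul1r coefB coefXM; case: j.
have [szD revD] : (size D <= e.+2)%N /\ rev_poly e.+1 D = - D.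
  have [szr Er] := rec_r; split.
    by rewrite (leq_trans (size_polyMleq _ _)) // (size_1subXn 1) //=.
  by rewrite -add1n rev_polyM ?(size_1subXn 1) // (rev_poly_1subXn 1) Er mulNr.
have D_anti j : (j <= e.+1)%N -> D`_(e.+1 - j) = - D`_j.
  by move=> je; rewrite -coefN -revD coef_poly ltnS je.
have diffE : (p * r)`_k.+1 - (p * r)`_k = \sum_(j < e.+2) D`_j * P j.
  have -> : (p * r)`_k.+1 - (p * r)`_k = (D * p)`_k.+1.
    by rewrite /D mulrBl mul1r mulrBl -mulrA coefB coefXM (mulrC p).
  have DE : D = \sum_(j < e.+2) D`_j *: 'X^j.
    rewrite -poly_def; apply/polyP => j; rewrite coef_poly.
    by case: ltnP => // /(leq_trans szD) /leq_sizeP ->.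
  rewrite [X in X * p]DE mulr_suml coef_sum; apply: eq_bigr => j _.
  by rewrite -scalerAl coefZ coefXnM.
(* The indices k + 1 - j and k - e + j add up to 2k + 1 - e, which is at most d because 2k < d +
   e. *)
have pair_ge0 j : (2 * j <= e.+1)%N -> 0 <= D`_j * (P j - P (e.+1 - j)%N).
  move=> je; apply: mulr_ge0.
    rewrite D_coef subr_ge0; case: j je => // j je; apply: r_mono; lia.
  rewrite subr_ge0 /P; case: ifP => [_|far]; first by case: ifP.
  rewrite ifF; last lia.
  by apply: p_mono; lia.
(* D is antireciprocal, so reversing the summation gives
   [2 * sum = sum_j D_j (P j - P (e + 1 - j))], with nonnegative terms. *)
rewrite diffE -(pmulr_rge0 _ (ltr0Sn _ 1)) mulr_natl mulr2n.
rewrite [X in _ + X](reindex_inj rev_ord_inj) /= -big_split sumr_ge0 //= => j _.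
have je : (j <= e.+1)%N by rewrite -ltnS.
rewrite subSS D_anti // mulNr -mulrBr.
have [le|gt] := leqP (2 * j) e.+1; first exact: pair_ge0.
rewrite -[D`_j]opprK -D_anti // mulNr -mulrN opprB.
by rewrite -{3}[nat_of_ord j](subKn je) pair_ge0 //; lia.
Qed.

Lemma quotient_ge0 d j M (f g : {poly int}) :
  (0 < j <= M)%N -> reciprocal d f -> unimodal d f ->
  g * (1 - 'X^M) = (1 - 'X^j) * f -> forall i, 0 <= g`_i.
Proof.
case/andP=> j_gt0 jM rec_f [f_ge0 f_mono] E.
have M_gt0 := leq_trans j_gt0 jM.
have [dj|Mdj] := ltnP (d + j) M.
  have [->|g0 i] := eqVneq g 0; first by move=> i; rewrite coef0.
  have := size_mul g0 (subXn_neq0 _ M_gt0); rewrite E size_1subXn //.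
  have := size_polyMleq (1 - 'X^j) f; rewrite size_1subXn //.
  have := rec_f.1; have := g0; rewrite -size_poly_gt0.
  move: (size _) (size _) (size _); lia.
have rec_g : reciprocal (d + j - M) g.
  by apply: (reciprocal_cancel d M j _ _ f); rewrite ?subnK // E mulrC.
(* Here g_i = (f_i - f_{i-j}) + g_{i-M}, and the bound says i + (i - j) <= d, as unimodality of f
   requires. It reaches past the middle of g, of nominal degree d + j - M. *)
have low i : (2 * i <= d + j)%N -> 0 <= g`_i.
  elim/ltn_ind: i => i IH le.
  have := congr1 (fun p : {poly int} => p`_i) E.
  rewrite mulrBr mulrBl mulr1 mul1r !coefB coefMXn coefXnM => /eqP.
  rewrite subr_eq => /eqP->; apply: addr_ge0.
    by rewrite subr_ge0; case: ltnP => // ?; apply: f_mono; lia.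
  by case: ltnP => // ?; apply: IH; lia.
move=> i; have [le|gt] := leqP (2 * i) (d + j); first exact: low.
have [ie|ei] := leqP i (d + j - M).
  by rewrite -(reciprocal_coef _ _ _ rec_g ie) low //; lia.
by rewrite nth_default // (leq_trans rec_g.1).
Qed.

(** * Divisibility *)

Local Notation evalC z p := (map_poly (intr : int -> algC) p).[z].

Lemma eval_1subXn (z : algC) a : evalC z (1 - 'X^a) = 1 - z ^+ a.
Proof.
by rewrite rmorphB rmorph1 rmorphXn /= map_polyX hornerD hornerN hornerXn hornerC.
Qed.

(** Induction on k through [gauss_ratio]: d does not divide k + 1, so 1 - z^(k+1) cancels; then
    either d divides n - k or the residue of n is already below that of k. *)
Lemma gauss_root_of_unity (z : algC) d n k : d.-primitive_root z ->
  (n %% d < k %% d)%N -> evalC z (gauss n k) = 0.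
Proof.
move=> zd; have d_gt0 := prim_order_gt0 zd.
elim: k => [|k IH] lt; first by rewrite mod0n in lt.
have zk : z ^+ k.+1 != 1.
  by rewrite -[1](expr0 z) (eq_prim_root_expr zd) mod0n -lt0n (leq_trans _ lt).
have := congr1 (fun p => evalC z p) (gauss_ratio n k).
rewrite !rmorphM !hornerM !eval_1subXn => /eqP E.
apply/eqP; move: E; rewrite (_ : _ * evalC z (gauss n k) = 0).
  by rewrite mulf_eq0 subr_eq0 eq_sym (negPf zk).
have [nk|kn] := ltnP n k; first by rewrite gauss_small // rmorph0 horner0 mulr0.
have kSd : ((k.+1 %% d) = (k %% d).+1)%N.
  have := ltn_pmod k d_gt0; rewrite leq_eqVlt => /orP[/eqP kd|kd].
    by move: lt; rewrite -(addn1 k) -modnDml addn1 kd modnn.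
  by rewrite -(addn1 k) -modnDml addn1 modn_small.
have [/eqP nkd|nkd] := eqVneq (n %% d)%N (k %% d)%N.
  rewrite eqn_mod_dvd // in nkd.
  by move: nkd; rewrite (prim_order_dvd zd) => /eqP->; rewrite subrr mul0r.
by rewrite IH ?mulr0 //; lia.
Qed.

(** Division by the monic X^M - 1 stays over Z; the remainder has size at most M but M distinct
    complex roots, so it is 0. *)
Lemma dvd_1subXn M (p : {poly int}) : (0 < M)%N ->
  (forall z : algC, z ^+ M = 1 -> evalC z p = 0) ->
  exists g, g * (1 - 'X^M) = p.
Proof.
move=> M_gt0 roots.
have [z zM] := C_prim_root_exists M_gt0.
have mon : 'X^M - 1 \is @monic int by apply: monicXnsubC.
have szX : size ('X^M - 1 : {poly int}) = M.+1 by apply: size_XnsubC.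
have pE := Pdiv.RingMonic.rdivp_eq mon p.
set q := Pdiv.Ring.rdivp _ _ in pE; set r := Pdiv.Ring.rmodp _ _ in pE.
have szr : (size r <= M)%N.
  by rewrite -ltnS -szX; apply: Pdiv.Ring.ltn_rmodpN0; exact: monic_neq0.
suff r0 : r = 0 by exists (- q); rewrite mulNr -mulrN opprB [RHS]pE r0 addr0.
have evr (w : algC) : w ^+ M = 1 -> evalC w r = 0.
  move=> wM; have := roots w wM.
  rewrite pE rmorphD rmorphM hornerD hornerM -opprB rmorphN hornerN eval_1subXn.
  by rewrite wM subrr oppr0 mulr0 add0r.
apply: (map_inj_poly (intr_inj : injective (intr : int -> algC)) (erefl _)).
rewrite rmorph0.
pose rs := [seq z ^+ i | i <- iota 0 M].
apply: (@roots_geq_poly_eq0 _ _ rs).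
- apply/allP => _ /mapP[i _ ->]; apply/rootP/evr.
  by rewrite exprAC (prim_expr_order zM) expr1n.
- rewrite map_inj_in_uniq ?iota_uniq // => i j; rewrite !mem_iota /= => iM jM.
  by move/eqP; rewrite (eq_prim_root_expr zM) !modn_small // => /eqP.
- by rewrite size_map size_iota (leq_trans (size_poly _ _)).
Qed.

(** Subtractive Euclid: 1 - X^(b-a) = (1 - X^b) - X^(b-a) (1 - X^a), so Bezout holds with integer
    coefficients. *)
Lemma gcd_comb_1subXn a b : exists u v : {poly int},
  1 - 'X^(gcdn a b) = u * (1 - 'X^a) + v * (1 - 'X^b).
Proof.
elim/ltn_ind: {a b}(a + b)%N {-2}a {-2}b (erefl (a + b)%N) => s IH a b sE.
wlog ab : a b sE / (a <= b)%N => [wl|].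
  have [/wl|/ltnW/wl] := leqP a b; first exact.
  by rewrite addnC gcdnC => /(_ sE)[u [v ->]]; exists v, u; rewrite addrC.
case: a => [|a] in sE ab *.
  by rewrite gcd0n; exists 0, 1; rewrite mul0r mul1r add0r.
have [|u [v]] := IH b _ a.+1 (b - a.+1)%N (subnKC ab); first lia.
move=> E; rewrite -{1}(subnKC ab) gcdnDl.
exists (u - v * 'X^(b - a.+1)), v; rewrite E.
rewrite -{3}(subnK ab) exprD; ring.
Qed.

Lemma qbinomE n k : (k <= n)%N -> qbinom n k = FracField.tofrac (gauss n k).
Proof.
move=> kn; rewrite /qbinom kn.
have qE a : 1 - qvar ^+ a = FracField.tofrac (1 - 'X^a).
  by rewrite tofracB tofrac1 tofracXn.
have den_neq0 : \prod_(i < k) (1 - qvar ^+ i.+1) != 0.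
  by apply/prodf_neq0 => i _; rewrite qE tofrac_eq0 subXn_neq0.
apply: (mulIf den_neq0); rewrite divfK // {den_neq0}.
elim: k kn => [|k IH] kn; first by rewrite !big_ord0 gauss0 tofrac1 mulr1.
have R := congr1 (@FracField.tofrac _) (gauss_ratio n k).
rewrite !tofracM -!qE in R.
rewrite !big_ord_recr /= (IH (ltnW kn)).
rewrite mulrCA (mulrC (FracField.tofrac (gauss n k.+1))) R; ring.
Qed.

(** * Residues and carries modulo d *)

Lemma modn_pred w d : (0 < w)%N -> (0 < d)%N ->
  ((w - 1) %% d = if w %% d == 0 then d.-1 else (w %% d).-1)%N.
Proof.
move=> w_gt0 d_gt0; rewrite {1}(divn_eq w d).
have := ltn_pmod w d_gt0; have := divn_eq w d.
move: (w %% d)%N (w %/ d)%N => s q wE sd.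
have [s0|s_gt0] := posnP s.
  have -> : (q * d + s - 1 = q.-1 * d + d.-1)%N by case: q wE => [|q]; nia.
  by rewrite modnMDl modn_small //; lia.
have -> : (q * d + s - 1 = q * d + s.-1)%N by lia.
by rewrite modnMDl modn_small //; lia.
Qed.

Lemma modn_compl u v d : (0 < d)%N -> (d %| u + v)%N ->
  (v %% d = if u %% d == 0 then 0 else d - u %% d)%N.
Proof.
move=> d_gt0; rewrite /dvdn -modnDm => /dvdnP[t E].
have := ltn_pmod u d_gt0; have := ltn_pmod v d_gt0.
move: (u %% d)%N (v %% d)%N E => x y E xd yd.
have t2 : (t < 2)%N by nia.
by case: t t2 E => [|[|t]] // _ E; case: ifP => x0; lia.
Qed.

(** Let x and s be the residues of am and am + bm; those of an and an + bn are their complements.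
    For s > 0 the alternatives read s - 1 < x and x < s; for s = 0 the second holds. *)
Lemma exists_carry a b m n d : (0 < d)%N -> (0 < a * m + b * m)%N ->
  (d %| m + n)%N -> ~~ (d %| a * m)%N ->
  ((a * m + b * m - 1) %% d < (a * m) %% d)%N
  || ((a * n + b * n) %% d < (a * n) %% d)%N.
Proof.
move=> d_gt0 w_gt0 dmn; rewrite /dvdn => x_neq0.
rewrite modn_pred // (modn_compl (a * m + b * m) (a * n + b * n)) //;
  last first.
  by rewrite addnACA -!mulnDr -mulnDl dvdn_mull.
rewrite (modn_compl (a * m) (a * n)) ?(negPf x_neq0) //; last first.
  by rewrite -mulnDr dvdn_mull.
have := ltn_pmod (a * m) d_gt0; have := ltn_pmod (a * m + b * m) d_gt0.
move: (_ %% d)%N x_neq0 (_ %% d)%N => x x0 s sd xd.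
by case: ifP => s0; lia.
Qed.

Theorem theorem6p1 (a b m n : nat)
    (ha : (1 <= a)%N) (hb : (1 <= b)%N) (hm : (1 <= m)%N) (hn : (1 <= n)%N) :
  is_nonneg_int_poly
    ((1 - qvar ^+ gcdn (a * m) (m + n)) / (1 - qvar ^+ (m + n))
     * qbinom (a * m + b * m - 1) (a * m)
     * qbinom (a * n + b * n) (a * n)).
Proof.
have mn_gt0 : (0 < m + n)%N by lia.
have bm_gt0 : (0 < b * m)%N by rewrite muln_gt0 hb.
have w_gt0 : (0 < a * m + b * m)%N by rewrite addn_gt0 bm_gt0 orbT.
have kA : (a * m <= a * m + b * m - 1)%N by lia.
have kB : (a * n <= a * n + b * n)%N by apply: leq_addr.
rewrite !qbinomE //.
set A := gauss _ _; set B := gauss _ _; set j := gcdn _ _.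
have [h hE] : exists h, h * (1 - 'X^(m + n)) = (1 - 'X^(a * m)) * (A * B).
  apply: dvd_1subXn => // z zmn.
  have [d zd dmn] := prim_order_exists mn_gt0 zmn.
  rewrite !rmorphM !hornerM eval_1subXn.
  have [dam|ndam] := boolP (d %| a * m)%N.
    by move: dam; rewrite (prim_order_dvd zd) => /eqP->; rewrite subrr mul0r.
  have /orP[lt|lt] := exists_carry a b m n d (prim_order_gt0 zd) w_gt0 dmn ndam.
  - by rewrite /A (gauss_root_of_unity _ _ _ _ zd lt) mul0r mulr0.
  - by rewrite /B (gauss_root_of_unity _ _ _ _ zd lt) !mulr0.
have [u [v uv]] := gcd_comb_1subXn (a * m) (m + n).
(* Obtained by multiplying the Bezout identity [uv] by A B and dividing by 1 - X^(m+n). *)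
pose g := u * h + v * (A * B).
have gE : g * (1 - 'X^(m + n)) = (1 - 'X^j) * (A * B).
  by rewrite /g mulrDl -(mulrA u) hE uv; ring.
exists g; split.
  have q_neq0 : 1 - qvar ^+ (m + n) != 0.
    by rewrite -tofracXn -tofrac1 -tofracB tofrac_eq0 subXn_neq0.
  apply: (mulIf q_neq0); rewrite mulrAC (mulrAC (_ / _)) divfK //.
  have := congr1 (@FracField.tofrac _) gE.
  by rewrite !tofracM !tofracB !tofrac1 !tofracXn mulrA => ->.
apply: (quotient_ge0 _ _ _ _ _ _ _ _ gE).
- rewrite gcdn_gt0 mn_gt0 orbT dvdn_leq ?dvdn_gcdr //.
- by apply: reciprocalM; apply: reciprocal_gauss.
- by apply: unimodalM; first [exact: reciprocal_gauss | exact: unimodal_gauss].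
Qed.
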